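(* Let $a_0$ be the unique solution of $27a^2-54a^3=-1$ in the interval $(1/2,2/3)$, and for $a\in(0,1)$ let $S_a$ be the set of all points $x\in[0,1]$ for which $F_a'(x)$ does not exist. Then the Lebesgue measure of $S_{a_0}$ satisfies $|S_{a_0}|=1$.
   Context: For $a\in(0,1)$ the function $F_a:[0,1]\to[0,1]$ is defined as follows. Define continuous functions $f_i:[0,1]\to[0,1]$, $i\ge 0$, inductively: $f_0(x)=x$ for all $x\in[0,1]$; each $f_i$ is continuous on $[0,1]$ and affine on each subinterval $[k/3^i,(k+1)/3^i]$, $k\in\{0,1,\ldots,3^i-1\}$; and for all $i\ge 0$ and $k\in\{0,1,\ldots,3^i-1\}$, $$f_{i+1}\left(\frac{k}{3^i}\right)=f_i\left(\frac{k}{3^i}\right),\qquad f_{i+1}\left(\frac{3k+1}{3^{i+1}}\right)=f_i\left(\frac{k}{3^i}\right)+a\left[f_i\left(\frac{k+1}{3^i}\right)-f_i\left(\frac{k}{3^i}\right)\right],$$ $$f_{i+1}\left(\frac{3k+2}{3^{i+1}}\right)=f_i\left(\frac{k}{3^i}\right)+(1-a)\left[f_i\left(\frac{k+1}{3^i}\right)-f_i\left(\frac{k}{3^i}\right)\right],\qquad f_{i+1}\left(\frac{k+1}{3^i}\right)=f_i\left(\frac{k+1}{3^i}\right).$$ Then $F_a=\lim_{i\to\infty}f_i$. The derivative $F_a'(x)$ is said to exist when the difference quotient of $F_a$ at $x$ has a finite limit (one-sided at the endpoints $0$ and $1$). *)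

(* Defs.v *)
From HB Require Import structures.
From mathcomp Require Import all_boot all_order all_algebra.
From mathcomp Require Import all_classical all_reals all_analysis.
From mathcomp Require Import ring lra.
Set Implicit Arguments.
Unset Strict Implicit.
Unset Printing Implicit Defensive.
Import Order.TTheory GRing.Theory Num.Theory.
Import numFieldNormedType.Exports.
Local Open Scope classical_set_scope.
Local Open Scope ring_scope.

(* The continuous piecewise affine map of [0, 1] with nodes (0, 0),
   (1/3, a), (2/3, 1 - a), (1, 1). *)
Definition okamoto_step {R : realType} (a s : R) : R :=
  if s <= 1 / 3 then 3 * a * s
  else if s <= 2 / 3 then a + (1 - 2 * a) * (3 * s - 1)
  else (1 - a) + a * (3 * s - 2).

(* On the triadic interval [k / 3 ^ j, (k + 1) / 3 ^ j] containing x, the graph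
   of the j-th approximation is a segment, which the next one replaces by an
   affine copy of the graph of okamoto_step a. Only the values on [0, 1] matter;
   at x = 1 the factor okamoto_step a 0 = 0 cancels the value at
   (3 ^ j + 1) / 3 ^ j. *)
Fixpoint okamoto_approx {R : realType} (a : R) (i : nat) (x : R) : R :=
  if i is j.+1 then
    let k := Num.truncn (3 ^+ j * x) in
    let u := okamoto_approx a j (k%:R / 3 ^+ j) in
    let v := okamoto_approx a j (k.+1%:R / 3 ^+ j) in
    u + okamoto_step a (3 ^+ j * x - k%:R) * (v - u)
  else x.

Definition okamoto {R : realType} (a x : R) : R :=
  lim (okamoto_approx a i x @[i --> \oo]).

(* Restricting the quotient to points of [0, 1] makes it one-sided at 0 and 1. *)
Definition has_derivative01 {R : realType} (F : R -> R) (x : R) : Prop :=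
  exists l : R, (F y - F x) / (y - x) @[y --> within `[0, 1] x^'] --> l.

Definition nondiff01 {R : realType} (F : R -> R) : set R :=
  [set x | 0 <= x <= 1 /\ ~ has_derivative01 F x].

Lemma has_derivative01_derivable {R : realType} (F : R -> R) (x : R) :
  0 < x < 1 -> has_derivative01 F x <-> derivable F x 1.
Proof.
move=> x01.
have withinE : within `[0, 1] x^' = x^'.
  apply/funext => P; apply/propext; split; last first.
    by move=> H; apply: filterS H => y Py _.
  have : x^' `[0, 1]%classic.
    apply: nbhs_dnbhs; have := near_in_itvoo x01.
    by apply: filterS => y /subset_itv_oo_cc.
  by move=> H0 H1; apply: filterS2 H0 H1 => y Py; exact.
have shiftE : (F y - F x) / (y - x) @[y --> x^'] =
    (h^-1 *: ((F \o shift x) (h *: 1) - F x)) @[h --> 0^'].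
  apply/funext => P; apply/propext.
  rewrite /fmap /dnbhs /within /= !nbhs_simpl /=.
  pose Q y := y != x -> P ((F y - F x) / (y - x)).
  have sh : (\near x, Q x) = (\forall h \near 0, Q (h + x)).
    by rewrite (near_shift 0 x) subr0.
  suff: (\near x, Q x) <->
    (\forall h \near 0, h != 0 -> P (h^-1 *: (F (h%:A + x) - F x))) by [].
  rewrite sh {sh} /Q.
  have quotE h : h^-1 *: (F (h%:A + x) - F x) = (F (h + x) - F x) / h.
    by rewrite -[h%:A]/(h * 1) mulr1 mulrC.
  split; apply: filterS => h /=; rewrite quotE addrK -(subr_eq0 _ x) addrK; exact.
rewrite /has_derivative01 withinE shiftE /derivable; split.
  by move=> [l Fl]; apply/cvg_ex; exists l.
by move=> /cvg_ex[l Fl]; exists l.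
Qed.

(* The inductive characterization by continuity, affinity on the intervals
   [k / 3 ^ i, (k + 1) / 3 ^ i] and values at the triadic points; it determines
   the functions on [0, 1] (okamoto_approx_unique), and okamoto_approx satisfies
   it (okamoto_approxP). *)
Record okamoto_approx_spec {R : realType} (a : R) (f : nat -> R -> R) : Prop := {
  okamoto_spec0 : forall x : R, 0 <= x <= 1 -> f 0 x = x;
  okamoto_spec_cont : forall i, {within `[0, 1], continuous (f i)};
  okamoto_spec_affine : forall i k, (k < 3 ^ i)%N -> exists p q : R,
    forall x : R, k%:R / 3 ^+ i <= x <= k.+1%:R / 3 ^+ i -> f i x = p * x + q;
  okamoto_spec_l : forall i k, (k < 3 ^ i)%N ->
    f i.+1 (k%:R / 3 ^+ i) = f i (k%:R / 3 ^+ i);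
  okamoto_spec_1 : forall i k, (k < 3 ^ i)%N ->
    f i.+1 ((3 * k + 1)%:R / 3 ^+ i.+1) = f i (k%:R / 3 ^+ i)
      + a * (f i (k.+1%:R / 3 ^+ i) - f i (k%:R / 3 ^+ i));
  okamoto_spec_2 : forall i k, (k < 3 ^ i)%N ->
    f i.+1 ((3 * k + 2)%:R / 3 ^+ i.+1) = f i (k%:R / 3 ^+ i)
      + (1 - a) * (f i (k.+1%:R / 3 ^+ i) - f i (k%:R / 3 ^+ i));
  okamoto_spec_r : forall i k, (k < 3 ^ i)%N ->
    f i.+1 (k.+1%:R / 3 ^+ i) = f i (k.+1%:R / 3 ^+ i) }.

Lemma okamoto_approxS {R : realType} (a : R) (j k : nat) (x : R) :
  k%:R / 3 ^+ j <= x <= k.+1%:R / 3 ^+ j ->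
  okamoto_approx a j.+1 x = okamoto_approx a j (k%:R / 3 ^+ j) +
    okamoto_step a (3 ^+ j * x - k%:R) *
    (okamoto_approx a j (k.+1%:R / 3 ^+ j) - okamoto_approx a j (k%:R / 3 ^+ j)).
Proof.
have e0 : (0 : R) < 3 ^+ j by rewrite exprn_gt0.
rewrite ler_pdivrMr // ler_pdivlMr // (mulrC x) => /andP[kx].
rewrite le_eqVlt => /orP[/eqP xk|xk]; last first.
  have -> : okamoto_approx a j.+1 x = let k := Num.truncn (3 ^+ j * x) in
    let u := okamoto_approx a j (k%:R / 3 ^+ j) in
    let v := okamoto_approx a j (k.+1%:R / 3 ^+ j) in
    u + okamoto_step a (3 ^+ j * x - k%:R) * (v - u) by [].
  by rewrite (@truncn_def _ _ k) ?kx.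
rewrite /= xk natrK subrr -natr1 addrAC subrr add0r /okamoto_step.
have -> : ((0 : R) <= 1 / 3) by lra.
have -> : ((1 : R) <= 1 / 3) = false by apply/negbTE; rewrite -ltNge; lra.
have -> : ((1 : R) <= 2 / 3) = false by apply/negbTE; rewrite -ltNge; lra.
by ring.
Qed.

Lemma affine_pieces_continuous {R : realType} (g : R -> R) (m : nat) (d : R) :
  0 < d ->
  (forall k, (k < m)%N -> exists p q : R,
    forall x : R, k%:R / d <= x <= k.+1%:R / d -> g x = p * x + q) ->
  {within `[0, m%:R / d], continuous g}.
Proof.
move=> d0; elim: m => [_|m IH H].
  rewrite mul0r set_itv1; exact: continuous_subspace1.
have -> : `[0, m.+1%:R / d]%classic = `[0, m%:R / d] `|` `[m%:R / d, m.+1%:R / d].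
  have m0 : 0 <= m%:R / d by rewrite divr_ge0 // ltW.
  have mS : m%:R / d <= m.+1%:R / d by rewrite ler_pM2r ?invr_gt0 // ler_nat.
  apply/seteqP; split => x /=; rewrite !in_itv /=.
    by move=> /andP[x0 x1]; have [xm|/ltW mx] := leP x (m%:R / d);
      [left|right]; apply/andP.
  by case=> /andP[x0 x1]; apply/andP; split => //;
    [exact: le_trans mS|exact: le_trans x0].
apply: withinU_continuous; [exact: itv_closed|exact: itv_closed| |].
  by apply: IH => k km; apply: H; rewrite ltnS ltnW.
have [p [q Hg]] := H m (ltnSn m).
apply: (@subspace_eq_continuous _ _ _ (fun x => p * x + q)).
  by move=> x; rewrite inE /= in_itv /= => /Hg /esym.
apply: continuous_subspaceT => x.
by apply: cvgD; [apply: cvgM; [exact: cvg_cst|exact: cvg_id]|exact: cvg_cst].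
Qed.

Lemma okamoto_approxP {R : realType} (a : R) :
  okamoto_approx_spec a (okamoto_approx a).
Proof.
have e0 i : (0 : R) < 3 ^+ i by rewrite exprn_gt0.
have e1 i : (3 ^+ i : R) != 0 by rewrite gt_eqF.
have aff i k : (k < 3 ^ i)%N -> exists p q : R,
    forall x : R, k%:R / 3 ^+ i <= x <= k.+1%:R / 3 ^+ i -> okamoto_approx a i x = p * x + q.
  case: i => [_|j _]; first by exists 1, 0 => x _ /=; ring.
  set h := (k %/ 3)%N; set r := (k %% 3)%N.
  have kE : k = (h * 3 + r)%N := divn_eq k 3.
  have r3 : (r < 3)%N by rewrite ltn_mod.
  have sub (x : R) : k%:R / 3 ^+ j.+1 <= x <= k.+1%:R / 3 ^+ j.+1 ->
      (r%:R <= 3 * (3 ^+ j * x - h%:R) <= r%:R + 1).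
    rewrite ler_pdivrMr // ler_pdivlMr // exprS -natr1 kE natrD natrM.
    move=> /andP[h1 h2]; apply/andP; split; lra.
  have sub' (x : R) : r%:R <= 3 * (3 ^+ j * x - h%:R) <= r%:R + 1 ->
      h%:R / 3 ^+ j <= x <= h.+1%:R / 3 ^+ j.
    rewrite ler_pdivrMr // ler_pdivlMr // -natr1 => /andP[h1 h2].
    have r0 : (0 : R) <= r%:R by [].
    have r2 : (r%:R : R) <= 2 by rewrite ler_nat -ltnS.
    apply/andP; split; lra.
  set u := okamoto_approx a j (h%:R / 3 ^+ j).
  set v := okamoto_approx a j (h.+1%:R / 3 ^+ j).
  suff [p [q Hpq]] : exists p q : R, forall s, r%:R <= 3 * s <= r%:R + 1 ->
      okamoto_step a s = p * s + q.
    exists (p * 3 ^+ j * (v - u)), (u + (q - p * h%:R) * (v - u)) => x /sub hx.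
    rewrite (okamoto_approxS _ (sub' _ hx)) Hpq // -/u -/v; ring.
  case: r r3 {kE sub sub'} => [|[|[|//]]] _.
  - exists (3 * a), 0 => s /andP[s0 s1]; rewrite /okamoto_step ifT; [ring|lra].
  - exists (3 * (1 - 2 * a)), (a - (1 - 2 * a)) => s /andP[s0 s1].
    rewrite /okamoto_step; case: ifPn => [?|_]; last by rewrite ifT; [ring|lra].
    have -> : s = 1 / 3 by lra.
    by field.
  - exists (3 * a), (1 - 3 * a) => s /andP[s0 s1].
    rewrite /okamoto_step ifF; last by apply/negbTE; rewrite -ltNge; lra.
    case: ifPn => [?|_]; last by ring.
    have -> : s = 2 / 3 by lra.
    by field.
have node i (k r : nat) : (r <= 3)%N ->
    okamoto_approx a i.+1 ((3 * k + r)%:R / 3 ^+ i.+1) = okamoto_approx a i (k%:R / 3 ^+ i) +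
    okamoto_step a (r%:R / 3) *
    (okamoto_approx a i (k.+1%:R / 3 ^+ i) - okamoto_approx a i (k%:R / 3 ^+ i)).
  move=> r3; have r3' : (r%:R : R) <= 3 by rewrite ler_nat.
  have r0 : (0 : R) <= r%:R by [].
  rewrite (@okamoto_approxS _ _ _ k).
    congr (_ + okamoto_step a _ * _); rewrite exprS natrD natrM; field.
    by rewrite e1.
  have -> : (3 * k + r)%:R / 3 ^+ i.+1 = (k%:R + r%:R / 3) / 3 ^+ i :> R.
    by rewrite exprS natrD natrM; field; rewrite e1.
  by rewrite !ler_pM2r ?invr_gt0 // -[k.+1%:R]natr1; apply/andP; split; lra.
have step0 : okamoto_step a (0%:R / 3) = 0 :> R.
  by rewrite /okamoto_step ifT; [ring|lra].
have step1 : okamoto_step a (1%:R / 3) = a :> R.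
  by rewrite /okamoto_step ifT; [field|lra].
have step2 : okamoto_step a (2%:R / 3) = 1 - a :> R.
  rewrite /okamoto_step ifF; last by apply/negbTE; rewrite -ltNge; lra.
  by rewrite ifT; [field|lra].
have step3 : okamoto_step a (3%:R / 3) = 1 :> R.
  rewrite /okamoto_step ifF; last by apply/negbTE; rewrite -ltNge; lra.
  by rewrite ifF; [field|apply/negbTE; rewrite -ltNge; lra].
have nodeE i k : k%:R / 3 ^+ i = (3 * k)%:R / 3 ^+ i.+1 :> R.
  by rewrite exprS natrM; field; rewrite e1.
split => //.
- move=> i; have := @affine_pieces_continuous R (okamoto_approx a i) (3 ^ i) (3 ^+ i) (e0 i) (aff i).
  by rewrite natrX divff.
- by move=> i k _; rewrite [in LHS]nodeE -[(3 * k)%N]addn0 node // step0; ring.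
- by move=> i k _; rewrite node // step1.
- by move=> i k _; rewrite node // step2.
- move=> i k _; rewrite [in LHS]nodeE mulnS addnC node // step3; ring.
Qed.

Lemma okamoto_approx_unique {R : realType} (a : R) (f g : nat -> R -> R) :
  okamoto_approx_spec a f -> okamoto_approx_spec a g ->
  forall i (x : R), 0 <= x <= 1 -> f i x = g i x.
Proof.
move=> Sf Sg i.
have e0 j : (0 : R) < 3 ^+ j by rewrite exprn_gt0.
suff node : forall k, (k <= 3 ^ i)%N -> f i (k%:R / 3 ^+ i) = g i (k%:R / 3 ^+ i).
  move=> x /andP[x0 x1].
  have [k ki kx] : exists2 k, (k < 3 ^ i)%N & k%:R / 3 ^+ i <= x <= k.+1%:R / 3 ^+ i.
    have [x1'|x1'] := ltP x 1; last first.
      exists (3 ^ i).-1; first by rewrite prednK // expn_gt0.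
      have -> : x = 1 by apply/eqP; rewrite eq_le x1 x1'.
      rewrite ler_pdivrMr // ler_pdivlMr // mul1r prednK ?expn_gt0 // natrX lexx andbT.
      by rewrite -natrX ler_nat leq_pred.
    have y0 : 0 <= 3 ^+ i * x by rewrite mulr_ge0 // ltW.
    exists (Num.truncn (3 ^+ i * x)).
      by rewrite truncn_lt_nat // natrX -[ltRHS]mulr1 ltr_pM2l.
    have /andP[h1 h2] := truncn_itv y0.
    by rewrite ler_pdivrMr // ler_pdivlMr // (mulrC x) h1 ltW.
  have uv : k%:R / 3 ^+ i < k.+1%:R / 3 ^+ i :> R.
    by rewrite ltr_pM2r ?invr_gt0 // ltr_nat.
  have := okamoto_spec_affine Sf ki; have := okamoto_spec_affine Sg ki.
  have := node _ (ltnW ki); have := node _ ki; move: uv kx.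
  set u := k%:R / 3 ^+ i; set v := k.+1%:R / 3 ^+ i => uv kx Ev Eu.
  have uu : u <= u <= v by rewrite lexx ltW.
  have vv : u <= v <= v by rewrite lexx ltW.
  move=> [p' [q' gE]] [p [q fE]].
  rewrite (fE _ uu) (gE _ uu) in Eu; rewrite (fE _ vv) (gE _ vv) in Ev.
  rewrite (fE _ kx) (gE _ kx).
  have pp : p = p'.
    apply/eqP; rewrite -subr_eq0.
    have : (p - p') * (v - u) = 0 by lra.
    by move/eqP; rewrite mulf_eq0 (subr_eq0 v) (gt_eqF uv) orbF.
  by move: Eu; rewrite pp => /addrI ->.
elim: i => [|i IH] k ki.
  have [k0 k1] : (0 : R) <= k%:R / 3 ^+ 0 /\ k%:R / 3 ^+ 0 <= (1 : R).
    by rewrite expr0 divr1 ler0n; split=> //; rewrite -[leRHS]/(1%:R) ler_nat.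
  have k01 := introT andP (conj k0 k1).
  by rewrite (okamoto_spec0 Sf k01) (okamoto_spec0 Sg k01).
have nodeE m : (3 * m)%:R / 3 ^+ i.+1 = m%:R / 3 ^+ i :> R.
  by rewrite exprS natrM; field; rewrite gt_eqF.
have [->|kn] := eqVneq k (3 ^ i.+1)%N.
  have t0 : (0 < 3 ^ i)%N by rewrite expn_gt0.
  have lt : ((3 ^ i).-1 < 3 ^ i)%N by rewrite prednK.
  have := okamoto_spec_r Sf lt; have := okamoto_spec_r Sg lt.
  by rewrite prednK // expnS nodeE => -> ->; exact: IH.
have {ki kn} : (k < 3 ^ i.+1)%N by rewrite ltn_neqAle kn.
rewrite (divn_eq k 3) (mulnC _ 3%N).
set h := (k %/ 3)%N; have : (k %% 3 < 3)%N by rewrite ltn_mod.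
move=> r3 hk; have hi : (h < 3 ^ i)%N.
  by rewrite -(ltn_pmul2l (isT : 0 < 3)%N) -expnS (leq_ltn_trans _ hk) ?leq_addr.
case: (k %% 3)%N r3 {hk} => [|[|[|//]]] _.
- by rewrite addn0 nodeE (okamoto_spec_l Sf) // (okamoto_spec_l Sg) // IH // ltnW.
- by rewrite (okamoto_spec_1 Sf) // (okamoto_spec_1 Sg) // !IH // ltnW.
- by rewrite (okamoto_spec_2 Sf) // (okamoto_spec_2 Sg) // !IH // ltnW.
Qed.

Lemma okamoto_critical_unique (R : realType) :
  exists! a : R, 1 / 2 < a < 2 / 3 /\ 27 * a ^+ 2 - 54 * a ^+ 3 = -1.
Proof.
pose f (x : R) := 27 * x ^+ 2 - 54 * x ^+ 3.
have cf : {within `[1 / 2, 2 / 3], continuous f}.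
  apply: continuous_subspaceT => x; rewrite /f.
  by apply: cvgB; apply: cvgM; (exact: cvg_cst || exact: exprn_continuous).
have le12 : (1 / 2 : R) <= 2 / 3 by lra.
have f1 : f (1 / 2) = 0 by rewrite /f; field.
have f2 : f (2 / 3) = - 4 by rewrite /f; field.
have [|a /[!in_itv] /= /andP[a1 a2] fa] := IVT (v := -1) le12 cf.
  by rewrite f1 f2 ge_min le_max; apply/andP; split; apply/orP; [right|left]; lra.
exists a; split.
  split=> //; rewrite !lt_neqAle a1 a2 !andbT; apply/andP; split; apply/eqP => E.
    by move: fa; rewrite -E f1; lra.
  by move: fa; rewrite E f2; lra.
move=> b [/andP[b1 b2] fb]; apply/eqP; rewrite eq_sym -subr_eq0.
have : (b - a) * (27 * (b + a) - 54 * (b ^+ 2 + b * a + a ^+ 2)) = 0.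
  by transitivity (f b - f a); [rewrite /f; ring|rewrite fa /f fb; ring].
move/eqP; rewrite mulf_eq0 => /orP[//|/eqP E].
by exfalso; nra.
Qed.

(* Main.v *)
Require Import Defs.
From mathcomp Require Import all_boot all_order all_algebra.
From mathcomp Require Import all_classical all_reals all_analysis.
From mathcomp Require Import ring lra zify.
Set Implicit Arguments.
Unset Strict Implicit.
Unset Printing Implicit Defensive.
Import Order.TTheory GRing.Theory Num.Theory.
Import numFieldNormedType.Exports.
Local Open Scope classical_set_scope.
Local Open Scope ring_scope.

(** On every triadic cell [k / 3 ^ n, (k + 1) / 3 ^ n] the map F_a agrees at both
    ends with its n-th approximation, so a finite derivative at x forces the
    slopes of the approximations on the cells around x to stay bounded. Passing
    from a cell to its three children multiplies the slope by 3a, 3(1 - 2a) and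
    3a. The equation defining a0 says precisely that |3(1 - 2a)| = (3a) ^ -2,
    so the absolute slope is (3a) ^ W, where W is an integer walk along the
    triadic digits of x: it steps by +1 with probability 2/3 and by -2 with
    probability 1/3. This walk has mean zero and exceeds almost surely every
    bound; hence almost no x has bounded slopes.

    Since W rises one unit at a time, staying below the level M means that the
    distance M - W, which moves by -1 or +2, never hits 0. The probability of not
    having hit 0 in n steps is [survival], and its limit in n is a bounded
    harmonic function of the starting distance that vanishes at 0. The harmonic
    functions are the combinations of 1, m and (-2) ^ m, so this limit is zero
    ([survival_cvg0]). Probabilities are then turned into lengths without any
    probability space: [outer_measure_slopes_below] bounds, by induction on n,
    the outer measure of the points of a cell whose slopes stay below a power of
    3a. A countable union over this power shows that the points of
    differentiability form a null set ([differentiable_null]), which gives both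
    the measurability and the measure of its complement in [0, 1]. *)

(** * A mean-zero walk reaches 0 *)

(** The probability that a walk started at m, moving by -1 with probability 2/3
    and by +2 with probability 1/3, has not hit 0 during its first n steps. *)
Fixpoint survival (R : realType) (n m : nat) : R :=
  if m is m'.+1 then
    if n is n'.+1 then (2 * survival R n' m' + survival R n' m'.+3) / 3 else 1
  else 0.

Lemma survival0 (R : realType) n : survival R n 0 = 0.
Proof. by case: n. Qed.

Lemma survival_ge0_le1 (R : realType) n m : 0 <= survival R n m <= 1.
Proof.
elim: n m => [|n IH] [|m] /=; rewrite ?lexx ?ler01 //.
have /andP[a0 a1] := IH m; have /andP[b0 b1] := IH m.+3.
by apply/andP; split; lra.
Qed.

Lemma survivalS_le (R : realType) n m : survival R n.+1 m <= survival R n m.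
Proof.
elim: n m => [|n IH] [|m] //.
  by have /andP[] := survival_ge0_le1 R 1 m.+1.
rewrite -[leLHS]/((2 * survival R n.+1 m + survival R n.+1 m.+3) / 3).
rewrite -[leRHS]/((2 * survival R n m + survival R n m.+3) / 3).
have := IH m; have := IH m.+3; lra.
Qed.

Lemma eq0_of_mulrn_bounded (R : realType) (c K : R) :
  (forall n : nat, n%:R * `|c| <= K) -> c = 0.
Proof.
move=> cK; apply/eqP; rewrite -normr_eq0; apply/negPn/negP => c0.
have {}c0 : 0 < `|c| by rewrite lt_def c0 normr_ge0.
have := cK (Num.truncn (K / `|c|)).+1.
by rewrite -ler_pdivlMr // leNgt truncnS_gt.
Qed.

(** The recurrence has characteristic polynomial (X - 1) ^ 2 (X + 2). Second
    differences kill the double root 1 and leave a geometric sequence of ratio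
    -2, which is bounded only if it is zero; then q is linear and bounded. *)
Lemma bounded_harmonic_eq0 (R : realType) (q : nat -> R) :
  (forall m, 0 <= q m <= 1) -> q 0 = 0 ->
  (forall m, 3 * q m.+1 = 2 * q m + q m.+3) -> forall m, q m = 0.
Proof.
move=> q01 q0 qH.
pose e m := q m.+2 - 2 * q m.+1 + q m.
have eE m : e m = (-2) ^+ m * e 0%N.
  elim: m => [|m IH]; first by rewrite expr0 mul1r.
  rewrite exprS -mulrA -IH /e; have := qH m; lra.
have e0 : e 0%N = 0.
  apply: (@eq0_of_mulrn_bounded _ _ 2) => m.
  have em : `|e m| <= 2.
    have /andP[? ?] := q01 m; have /andP[? ?] := q01 m.+1.
    have /andP[? ?] := q01 m.+2.
    by rewrite ler_norml /e; apply/andP; split; lra.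
  apply: le_trans em; rewrite (eE m) normrM normrX normrN normr_nat.
  rewrite ler_wpM2r ?normr_ge0 //.
  by rewrite -natrX ler_nat ltnW // ltn_expl.
have q2 m : q m = m%:R * q 1%N.
  have [//] : q m = m%:R * q 1%N /\ q m.+1 = m.+1%:R * q 1%N.
  elim: m => [|m [IH1 IH2]]; first by rewrite q0 mul0r mul1r.
  split=> //; have := eE m; rewrite e0 mulr0 /e IH1 IH2 -!natr1; lra.
have q1 : q 1%N = 0.
  apply: (@eq0_of_mulrn_bounded _ _ 1) => m.
  have /andP[? ?] := q01 1%N.
  by rewrite ger0_norm // -q2; have /andP[] := q01 m.
by move=> m; rewrite q2 q1 mulr0.
Qed.

(** Survival probabilities decrease in time, and passing to the limit in their
    recursion gives a bounded harmonic function vanishing at 0. *)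
Lemma survival_cvg0 (R : realType) m : survival R n m @[n --> \oo] --> (0 : R).
Proof.
pose q k := lim (survival R n k @[n --> \oo]).
have cq k : survival R n k @[n --> \oo] --> q k.
  apply: nonincreasing_is_cvgn.
    apply/nonincreasing_seqP => n; exact: survivalS_le.
  exists 0 => _ [n _ <-]; by have /andP[] := survival_ge0_le1 R n k.
suff <- : q m = 0 by exact: cq.
apply: bounded_harmonic_eq0 => [k||k].
- apply/andP; split.
    apply: limr_ge; first by apply/cvg_ex; exists (q k); exact: cq.
    by near=> n; have /andP[] := survival_ge0_le1 R n k.
  apply: limr_le; first by apply/cvg_ex; exists (q k); exact: cq.
  by near=> n; have /andP[] := survival_ge0_le1 R n k.
- rewrite /q; under eq_fun do rewrite survival0; exact: lim_cst.
- have h1 : survival R n.+1 k.+1 @[n --> \oo] --> q k.+1.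
    by rewrite (cvg_shiftS (fun n => survival R n k.+1)); exact: cq.
  have h2 : survival R n.+1 k.+1 @[n --> \oo] --> (2 * q k + q k.+3) / 3.
    by apply: cvgMl; apply: cvgD; [apply: cvgMr; exact: cq|exact: cq].
  rewrite (cvg_unique _ h1 h2) //; field.
Unshelve. all: by end_near. Qed.

(** * Slopes on triadic cells *)

Definition slope {R : realType} (a : R) (n k : nat) : R :=
  3 ^+ n * (okamoto_approx a n (k.+1%:R / 3 ^+ n)
            - okamoto_approx a n (k%:R / 3 ^+ n)).

Lemma triadic_refine (R : realType) n k :
  k%:R / 3 ^+ n = (3 * k)%:R / 3 ^+ n.+1 :> R.
Proof. by rewrite exprS natrM; field; rewrite expf_neq0. Qed.

Lemma slope_children (R : realType) (a : R) n k : (k < 3 ^ n)%N ->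
  [/\ slope a n.+1 (3 * k) = 3 * a * slope a n k,
      slope a n.+1 (3 * k).+1 = 3 * (1 - 2 * a) * slope a n k
    & slope a n.+1 (3 * k).+2 = 3 * a * slope a n k].
Proof.
move=> kn; have S := okamoto_approxP a.
have E0 : okamoto_approx a n.+1 ((3 * k)%:R / 3 ^+ n.+1)
    = okamoto_approx a n (k%:R / 3 ^+ n).
  by rewrite -triadic_refine (okamoto_spec_l S kn).
have E3 : okamoto_approx a n.+1 ((3 * k).+3%:R / 3 ^+ n.+1)
    = okamoto_approx a n (k.+1%:R / 3 ^+ n).
  have -> : (3 * k).+3 = (3 * k.+1)%N by lia.
  by rewrite -triadic_refine (okamoto_spec_r S kn).
have := okamoto_spec_1 S kn; have := okamoto_spec_2 S kn.
rewrite addn1 addn2 => E2 E1.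
by rewrite /slope exprS; split; rewrite -exprS ?E0 ?E1 ?E2 ?E3 exprS; ring.
Qed.

(** Later approximations never move a node, so the sequence whose limit is F_a
    is eventually constant there. *)
Lemma okamoto_node (R : realType) (a : R) n k : (k <= 3 ^ n)%N ->
  okamoto a (k%:R / 3 ^+ n) = okamoto_approx a n (k%:R / 3 ^+ n).
Proof.
have S := okamoto_approxP a.
have stepE i j : (j <= 3 ^ i)%N ->
    okamoto_approx a i.+1 (j%:R / 3 ^+ i) = okamoto_approx a i (j%:R / 3 ^+ i).
  case: j => [_|j]; last exact: (okamoto_spec_r S).
  by apply: (okamoto_spec_l S); rewrite ?expn_gt0.
move=> kn.
have E i : okamoto_approx a (i + n) (k%:R / 3 ^+ n)
    = okamoto_approx a n (k%:R / 3 ^+ n).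
  elim: i => [//|i <-].
  have -> : k%:R / 3 ^+ n = (3 ^ i * k)%:R / 3 ^+ (i + n) :> R.
    by rewrite exprD natrM natrX; field; rewrite !expf_neq0.
  by rewrite addSn stepE // expnD leq_mul2l kn orbT.
rewrite /okamoto; apply/cvg_lim => //.
rewrite -(cvg_shiftn n) /=; under eq_fun do rewrite E; exact: cvg_cst.
Qed.

Definition slopes_below {R : realType} (a C : R) : set R :=
  [set x | forall n k, (k < 3 ^ n)%N ->
    k%:R / 3 ^+ n <= x <= k.+1%:R / 3 ^+ n -> `|slope a n k| < C].

Lemma has_derivative01_lipschitz (R : realType) (F : R -> R) (x : R) :
  has_derivative01 F x -> exists C d : R, 0 < d /\
    forall y, 0 <= y <= 1 -> `|y - x| < d -> `|F y - F x| <= C * `|y - x|.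
Proof.
move=> [l Fl].
have := @cvgr_norm_le _ _ _ _ _ _ _ Fl (`|l| + 1).
rewrite ltrDl ltr01 => /(_ _ isT).
rewrite near_withinE near_withinE => /nbhs_ballP -[d /= d0 H].
exists (`|l| + 1), d; split=> // y y01 yd.
have [->|yx] := eqVneq y x; first by rewrite !subrr normr0 mulr0.
have := H y; rewrite /ball /= distrC => /(_ yd yx).
rewrite in_itv /= => /(_ y01).
by rewrite normrM normfV ler_pdivrMr // normr_gt0 subr_eq0.
Qed.

(** A bound for the finitely many cells that are too large for the local
    Lipschitz estimate at x. *)
Lemma slope_le_pow (R : realType) (a : R) n k : 1 / 2 < a < 2 / 3 ->
  (k < 3 ^ n)%N -> `|slope a n k| <= (3 * a) ^+ n.
Proof.
move=> /andP[a1 a2].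
have step (c s : R) i : `|c| <= 3 * a -> `|s| <= (3 * a) ^+ i ->
    `|c * s| <= (3 * a) ^+ i.+1.
  by move=> hc hs; rewrite exprS normrM ler_pM.
elim: n k => [[|//] _|n IH k].
  by rewrite /slope /= !expr0 !divr1 subr0 mul1r normr1.
rewrite (divn_eq k 3) mulnC; have : (k %% 3 < 3)%N by rewrite ltn_mod.
rewrite expnS => r3 kn; have hn : (k %/ 3 < 3 ^ n)%N by lia.
have [E0 E1 E2] := slope_children a hn.
case: (k %% 3)%N r3 {kn} => [|[|[|//]]] _.
- by rewrite addn0 E0; apply: step; [rewrite ger0_norm; lra|exact: IH].
- by rewrite addn1 E1; apply: step; [rewrite ler_norml; lra|exact: IH].
- by rewrite addn2 E2; apply: step; [rewrite ger0_norm; lra|exact: IH].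
Qed.

Lemma exists_pow_gt (R : realType) (b C : R) : 1 < b -> exists n, C < b ^+ n.
Proof.
move=> b1.
have bernoulli n : 1 + n%:R * (b - 1) <= b ^+ n.
  elim: n => [|n IH]; first by rewrite expr0 mul0r addr0.
  rewrite exprS; apply: (@le_trans _ _ (b * (1 + n%:R * (b - 1)))).
    have : 0 <= n%:R * (b - 1) ^+ 2 by rewrite mulr_ge0 // sqr_ge0.
    rewrite -natr1; lra.
  by rewrite ler_pM2l //; lra.
exists (Num.truncn (C / (b - 1))).+1; apply: lt_le_trans (bernoulli _).
have : C < (Num.truncn (C / (b - 1))).+1%:R * (b - 1).
  by rewrite -ltr_pdivrMr ?truncnS_gt // subr_gt0.
lra.
Qed.

(** If |F y - F x| <= C |y - x| near x, then for u <= x <= v near x the two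
    increments add up to |F v - F u| <= C (v - u), even though neither end of
    the cell need be x. The bound is put in the form (3a) ^ M so that the walk
    W can be compared with the integer M. *)
Lemma slopes_bounded_of_derivative (R : realType) (a x : R) :
  1 / 2 < a < 2 / 3 -> 0 <= x <= 1 -> has_derivative01 (okamoto a) x ->
  exists M, slopes_below a ((3 * a) ^+ M) x.
Proof.
move=> a12 /andP[x0 x1] /has_derivative01_lipschitz[C [d [d0 H]]].
have [a1 a2] := andP a12.
have b1 : 1 < 3 * a by lra.
have [M0 CM] := exists_pow_gt C b1.
have [n0 dn] := @exists_pow_gt R 3 d^-1 ltac:(lra).
(* M0 serves the levels beyond n0, and n0.+1 the earlier ones. *)
exists (maxn M0 n0.+1) => n k kn /andP[ux xv].
have [nn0|n0n] := leqP n n0.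
  apply: (le_lt_trans (slope_le_pow a12 kn)).
  by rewrite ltr_eXn2l // leq_max ltnS nn0 orbT.
have p0 : (0 : R) < 3 ^+ n by rewrite exprn_gt0.
apply: (@le_lt_trans _ _ C); last first.
  by apply: (lt_le_trans CM); rewrite ler_eXn2l // leq_maxl.
rewrite /slope -!okamoto_node //; last exact: ltnW.
move: ux xv; set u := k%:R / 3 ^+ n; set v := k.+1%:R / 3 ^+ n => ux xv.
have uv : 3 ^+ n * (v - u) = 1.
  by rewrite /u /v -natr1; field; rewrite gt_eqF.
have vud : v - u < d.
  rewrite -(ltr_pM2l p0) uv -ltr_pdivrMr // div1r (lt_trans dn) //.
  by rewrite ltr_eXn2l // ltr1n.
have u0 : 0 <= u by rewrite divr_ge0 // ltW.
have v1 : v <= 1 by rewrite ler_pdivrMr // mul1r -natrX ler_nat.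
have Hu : `|okamoto a u - okamoto a x| <= C * (x - u).
  have <- : `|u - x| = x - u by rewrite distrC ger0_norm // subr_ge0.
  by apply: H; rewrite ?ltr_norml; apply/andP; split; lra.
have Hv : `|okamoto a v - okamoto a x| <= C * (v - x).
  have <- : `|v - x| = v - x by rewrite ger0_norm // subr_ge0.
  by apply: H; rewrite ?ltr_norml; apply/andP; split; lra.
rewrite normrM gtr0_norm //.
have -> : C = 3 ^+ n * (C * (v - u)) by rewrite mulrCA uv mulr1.
rewrite ler_pM2l //.
have -> : okamoto a v - okamoto a u =
  (okamoto a v - okamoto a x) - (okamoto a u - okamoto a x) by ring.
by apply: (le_trans (ler_normB _ _)); apply: (le_trans (lerD Hv Hu)); lra.
Qed.

(** For 1/2 < a the factor 3(1 - 2a) is negative, and the equation for a reads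
    (3a) ^ 2 * 3(2a - 1) = 1. *)
Lemma critical_slopes (R : realType) (a : R) :
  1 / 2 < a < 2 / 3 -> 27 * a ^+ 2 - 54 * a ^+ 3 = -1 ->
  `|3 * (1 - 2 * a)| * (3 * a) ^+ 2 = 1.
Proof.
move=> /andP[a1 a2] E; rewrite ler0_norm; last lra.
transitivity (- (27 * a ^+ 2 - 54 * a ^+ 3)); first ring.
by rewrite E opprK.
Qed.

(** * Points with bounded slopes form a null set *)

Definition triadic_cell {R : realType} (n k : nat) : set R :=
  [set x | k%:R / 3 ^+ n <= x <= k.+1%:R / 3 ^+ n].

Lemma triadic_cell_children (R : realType) n k :
  @triadic_cell R n k `<=` triadic_cell n.+1 (3 * k) `|`
    (triadic_cell n.+1 (3 * k).+1 `|` triadic_cell n.+1 (3 * k).+2).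
Proof.
rewrite /triadic_cell (triadic_refine _ _ k) (triadic_refine _ _ k.+1).
have -> : (3 * k.+1 = (3 * k).+3)%N by lia.
move=> x /= /andP[x0 x3].
have [x1|/ltW x1] := leP x ((3 * k).+1%:R / 3 ^+ n.+1); first by left; rewrite x0.
right; have [x2|/ltW x2] := leP x ((3 * k).+2%:R / 3 ^+ n.+1).
  by left; rewrite x1.
by right; rewrite x2.
Qed.

Lemma lebesgue_triadic_cell (R : realType) n k :
  lebesgue_measure (@triadic_cell R n k) = (3 ^- n)%:E.
Proof.
have -> : triadic_cell n k = `[k%:R / 3 ^+ n, k.+1%:R / 3 ^+ n]%classic :> set R.
  by apply/seteqP; split => x; rewrite /= in_itv.
rewrite lebesgue_measure_itv /=.
rewrite lte_fin ltr_pM2r ?invr_gt0 ?exprn_gt0 // ltr_nat ltnSn.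
by rewrite -EFinB -mulrBl -natr1 addrAC subrr add0r mul1r.
Qed.

Local Notation outer_lebesgue := ((wlength idfun)^*)%mu.

(** The exponent m is the distance of the walk to its level: at m = 0 the slope
    of the cell itself is C, so the set is empty. Otherwise the outer children
    have distance m - 1 and, by criticality, the middle one has distance m + 2;
    each is a third as long, so subadditivity reproduces the recursion of
    [survival]. Starting from an arbitrary cell is what makes the induction
    go through. *)
Lemma outer_measure_slopes_below (R : realType) (a C : R) n j k m :
  0 < a -> `|3 * (1 - 2 * a)| * (3 * a) ^+ 2 = 1 ->
  (k < 3 ^ j)%N -> `|slope a j k| * (3 * a) ^+ m = C ->
  (outer_lebesgue (slopes_below a C `&` triadic_cell j k)
    <= (survival R n m / 3 ^+ j)%:E)%E.
Proof.
move=> a0 crit.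
elim: n j k m => [|n IH] j k [|m] kj sC.
1,3: rewrite survival0 mul0r (_ : _ `&` _ = set0) ?outer_measure0 //.
1,2: apply/seteqP; split => // x [/(_ j k kj) /= H] /H.
1,2: by rewrite -sC mulr1 ltxx.
- apply: (@le_trans _ _ (outer_lebesgue (triadic_cell j k : set R))).
    by apply: le_outer_measure; exact: subIsetr.
  by rewrite [leLHS](lebesgue_triadic_cell R j k) mul1r.
- have [E0 E1 E2] := slope_children a kj.
  have kj' d : (d < 3)%N -> (3 * k + d < 3 ^ j.+1)%N by rewrite expnS; lia.
  have I0 : (outer_lebesgue (slopes_below a C `&` triadic_cell j.+1 (3 * k))
      <= (survival R n m / 3 ^+ j.+1)%:E)%E.
    apply: IH; first by rewrite -[(3 * k)%N]addn0 kj'.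
    by rewrite E0 -sC exprS normrM (@gtr0_norm _ (3 * a)) ?mulr_gt0 //; ring.
  have I1 : (outer_lebesgue (slopes_below a C `&` triadic_cell j.+1 (3 * k).+1)
      <= (survival R n m.+3 / 3 ^+ j.+1)%:E)%E.
    apply: IH; first by rewrite -addn1 kj'.
    rewrite E1 -sC normrM -[m.+3]/(2 + m.+1)%N exprD mulrACA.
    by rewrite crit mul1r.
  have I2 : (outer_lebesgue (slopes_below a C `&` triadic_cell j.+1 (3 * k).+2)
      <= (survival R n m / 3 ^+ j.+1)%:E)%E.
    apply: IH; first by rewrite -addn2 kj'.
    by rewrite E2 -sC exprS normrM (@gtr0_norm _ (3 * a)) ?mulr_gt0 //; ring.
  apply: le_trans.
    by apply: le_outer_measure; apply: setIS; exact: triadic_cell_children.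
  rewrite !setIUr; apply: (le_trans (outer_measureU2 _ _ _)).
  apply: (le_trans (leeD I0 (le_trans (outer_measureU2 _ _ _) (leeD I1 I2)))).
  rewrite -!EFinD lee_fin /= exprS le_eqVlt; apply/orP; left; apply/eqP.
  by field; rewrite expf_neq0.
Qed.

Lemma differentiable_null (R : realType) (a : R) :
  1 / 2 < a < 2 / 3 -> 27 * a ^+ 2 - 54 * a ^+ 3 = -1 ->
  outer_lebesgue [set x | 0 <= x <= 1 /\ has_derivative01 (okamoto a) x] = 0%E.
Proof.
move=> a12 crit; have [a1 a2] := andP a12.
pose E M := slopes_below a ((3 * a) ^+ M) `&` triadic_cell 0 0.
have E0 M : outer_lebesgue (E M) = 0%E.
  apply/eqP; rewrite eq_le outer_measure_ge0 andbT.
  have s0 : (survival R n M)%:E @[n --> \oo] --> (0 : R)%:E.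
    by apply: cvg_EFin; [exact: nearW|exact: survival_cvg0].
  rewrite -[leRHS](cvg_lim _ s0) //; apply: lime_ge.
    by apply/cvg_ex; exists 0%:E.
  apply: nearW => n; rewrite -[survival R n M]divr1 -[X in _ / X](expr0 3).
  apply: outer_measure_slopes_below => //.
  - lra.
  - exact: critical_slopes.
  - by rewrite /slope /= !expr0 !divr1 subr0 !mul1r normr1 mul1r.
apply/eqP; rewrite eq_le outer_measure_ge0 andbT.
apply: (@le_trans _ _ (outer_lebesgue (\bigcup_M E M))).
  apply: le_outer_measure => x [x01 /(slopes_bounded_of_derivative a12 x01)[M xM]].
  by exists M => //; split=> //; rewrite /triadic_cell /= expr0 !divr1.
apply: (le_trans (outer_measure_sigma_subadditive outer_lebesgue _)).
by rewrite eseries0 // => M _ _; exact: E0.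
Qed.

Theorem theorem1 (R : realType) (a0 : R) :
  1 / 2 < a0 < 2 / 3 ->
  27 * a0 ^+ 2 - 54 * a0 ^+ 3 = -1 ->
  ((wlength (@idfun R))^*)%mu.-cara.-measurable (nondiff01 (okamoto a0)) /\
  completed_lebesgue_measure (nondiff01 (okamoto a0)) = 1%E.
Proof.
move=> a12 crit; have N0 := differentiable_null a12 crit.
set N := [set x | _ /\ _] in N0.
have mN : outer_lebesgue.-cara.-measurable N.
  apply: le_caratheodory_measurable => X.
  rewrite -[leRHS]add0e; apply: leeD; last first.
    by apply: le_outer_measure; exact: subIsetl.
  by rewrite -N0; apply: le_outer_measure; exact: subIsetr.
have mI : outer_lebesgue.-cara.-measurable (`[0, 1]%classic : set R).
  by apply: sub_caratheodory; exact: measurable_itv.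
have DE : nondiff01 (okamoto a0) = `[0, 1]%classic `\` N.
  apply/seteqP; split => x /=; rewrite in_itv /= => -[x01 Nx]; split=> //.
    by move=> [].
  by move=> Dx; apply: Nx; split.
split; first by rewrite DE; exact: caratheodory_measurable_setD.
have I1 : outer_lebesgue (`[0, 1]%classic : set R) = 1%E.
  transitivity (lebesgue_measure (`[0, 1]%classic : set R)) => //.
  by rewrite lebesgue_measure_itv /= lte_fin ltr01 -EFinB subr0.
have -> : completed_lebesgue_measure (nondiff01 (okamoto a0))
  = outer_lebesgue (nondiff01 (okamoto a0)) by [].
apply/eqP; rewrite eq_le; apply/andP; split.
  by rewrite -I1; apply: le_outer_measure => x; rewrite DE => -[].
rewrite -I1 -[leRHS]adde0 -N0; apply: le_trans (outer_measureU2 _ _ _).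
apply: le_outer_measure => x xI; have [xN|xN] := pselect (N x); first by right.
by left; rewrite DE.
Qed.
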